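(* For any infinite cardinality $\lambda$ there is a theory $T={\rm Th}(\mathcal{A}_P)$ of a $P$-combination $\mathcal{A}_P$, in a language $\Sigma$, such that $|\Sigma|=\lambda$ and $e\text{-}{\rm Sp}(T)=2^\lambda$.
   Context: All languages are relational; symbols missing from the language of a structure in a family are interpreted by the empty relation. Let $(P_i)_{i\in I}$ be nonempty unary predicates (not necessarily disjoint) and $(\mathcal{A}_i)_{i\in I}$ structures such that $P_i$ is the universe of $\mathcal{A}_i$ and the symbols $P_i$ are not in the languages $\Sigma(\mathcal{A}_j)$. Let $\mathcal{A}_P$ be the union $\bigcup_{i\in I}\mathcal{A}_i$ (universe: union of the universes; relations: unions of the relations) expanded by the predicates $P_i$; it is the $P$-combination ${\rm Comb}_P(\mathcal{A}_i)_{i\in I}$ if $\mathcal{A}_i=(\mathcal{A}_P\upharpoonright A_i)\upharpoonright\Sigma(\mathcal{A}_i)$ for all $i\in I$, where $A_i$ is the universe of $\mathcal{A}_i$. Put $p_\infty(x)=\{\neg P_i(x)\mid i\in I\}$. Then $e\text{-}{\rm Sp}({\rm Th}(\mathcal{A}_P))$ is the number of pairwise elementarily non-equivalent (nonempty) restrictions of models $\mathcal{M}\models{\rm Th}(\mathcal{A}_P)$ to the set of realizations of $p_\infty(x)$ in $\mathcal{M}$; in particular it is $0$ if $p_\infty(x)$ is inconsistent with ${\rm Th}(\mathcal{A}_P)$. *)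

(* Defs.v *)
From mathcomp Require Import all_boot.
From mathcomp Require Import all_classical.

Set Implicit Arguments.
Unset Strict Implicit.
Unset Printing Implicit Defensive.

Local Open Scope classical_set_scope.

(* Relational languages; as usual, relation symbols have positive arity. *)
Record language := Language {
  symbol :> Type;
  arity : symbol -> nat;
  arity_gt0 : forall s, 0 < arity s }.

Definition sublanguage (L : language) (S : set L) : language :=
  @Language {s : L | S s} (fun s => arity (sval s))
    (fun s => arity_gt0 (sval s)).

(* First-order formulas with free variables among n de Bruijn indices; in
   [FAll phi], index 0 of [phi] is the bound variable. *)
Inductive formula (L : language) : nat -> Type :=
| FBot n : formula L n
| FEq n (x y : 'I_n) : formula L n
| FRel n (s : L) (x : (arity s).-tuple 'I_n) : formula L n
| FImp n (phi psi : formula L n) : formula L n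
| FAll n (phi : formula L n.+1) : formula L n.

Arguments FRel {L n} s x.

Definition sentence (L : language) : Type := formula L 0.

(* The universe is a subset of an ambient type [U], so that universes may
   overlap and unions and restrictions can be formed directly. It is not
   required to be nonempty here: nonemptiness is stated where it is needed. *)
Record structure (L : language) (U : Type) := Structure {
  univ : set U;
  interp : forall s : L, set ((arity s).-tuple U);
  interp_univ : forall s a, @interp s a -> forall k, univ (tnth a k) }.

Arguments interp {L U} _ _ _.

Fixpoint sat (L : language) (U : Type) (M : structure L U) (n : nat)
    (phi : formula L n) : n.-tuple U -> Prop :=
  match phi in formula _ m return m.-tuple U -> Prop with
  | FBot _ => fun _ => False
  | FEq _ x y => fun e => tnth e x = tnth e y
  | FRel _ s x => fun e => interp M s (map_tuple (tnth e) x)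
  | FImp _ f g => fun e => sat M f e -> sat M g e
  | FAll _ f => fun e => forall x, univ M x -> sat M f (cons_tuple x e)
  end.

Definition Th (L : language) (U : Type) (M : structure L U) :
    set (sentence L) :=
  [set phi | sat M phi (nil_tuple U)].

Definition models (L : language) (U : Type) (M : structure L U)
    (T : set (sentence L)) : Prop :=
  forall phi, T phi -> sat M phi (nil_tuple U).

Lemma restrict_subproof (L : language) (U : Type) (M : structure L U)
    (B : set U) (s : L) (a : (arity s).-tuple U) :
  interp M s a /\ (forall k, B (tnth a k)) ->
  forall k, (univ M `&` B) (tnth a k).
Proof. by move=> [Ma Ba] k; split; [exact: interp_univ Ma k|exact: Ba]. Qed.

Definition restriction (L : language) (U : Type) (M : structure L U)
    (B : set U) : structure L U :=
  @Structure L U (univ M `&` B)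
    (fun s => [set a | interp M s a /\ forall k, B (tnth a k)])
    (@restrict_subproof L U M B).

(* The language of a P-combination of structures in the languages [Sig i]:
   the union of these languages, together with a new unary symbol P_i,
   encoded as [inl i], for each index [i]. *)
Definition comb_symbol (I : Type) (L : language) (Sig : I -> set L) : Type :=
  (I + {s : L | exists i, Sig i s})%type.

Definition comb_arity (I : Type) (L : language) (Sig : I -> set L)
    (t : comb_symbol Sig) : nat :=
  match t with inl _ => 1 | inr s => arity (sval s) end.

Lemma comb_arity_gt0 (I : Type) (L : language) (Sig : I -> set L)
  (t : comb_symbol Sig) : 0 < comb_arity t.
Proof. by case: t => [//|s]; exact: arity_gt0. Qed.

Definition comb_language (I : Type) (L : language) (Sig : I -> set L) :
    language :=
  @Language (comb_symbol Sig) (@comb_arity I L Sig) (@comb_arity_gt0 I L Sig).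

Definition comb_incl (I : Type) (L : language) (Sig : I -> set L) (i : I)
    (s : sublanguage (Sig i)) : comb_language Sig :=
  inr (exist _ (sval s) (ex_intro _ i (svalP s))).

Definition comb_reduct (I : Type) (L : language) (Sig : I -> set L)
    (U : Type) (M : structure (comb_language Sig) U) (i : I) :
    structure (sublanguage (Sig i)) U :=
  @Structure (sublanguage (Sig i)) U (univ M)
    (fun s => interp M (comb_incl s))
    (fun s => @interp_univ _ _ M (comb_incl s)).

Section Combination.
Variables (I : Type) (L : language) (Sig : I -> set L) (U : Type).
Variable A : forall i, structure (sublanguage (Sig i)) U.

Definition comb_rel (t : comb_language Sig) : set ((arity t).-tuple U) :=
  match t return set ((comb_arity t).-tuple U) with
  | inl i => [set a | univ (A i) (thead a)]
  | inr s => [set a : (arity (sval s)).-tuple U |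
                exists (i : I) (h : Sig i (sval s)),
                  interp (A i) (exist _ (sval s) h) a]
  end.

Lemma comb_rel_univ (t : comb_language Sig) (a : (arity t).-tuple U) :
  comb_rel a -> forall k, (\bigcup_i univ (A i)) (tnth a k).
Proof.
case: t a => [i|s] a /=.
  by move=> Aa k; exists i => //; rewrite (ord1 k).
by move=> [i [h Aa]] k; exists i => //; exact: (interp_univ Aa).
Qed.

Definition comb : structure (comb_language Sig) U :=
  @Structure (comb_language Sig) U (\bigcup_i univ (A i)) comb_rel
    comb_rel_univ.

Definition is_Pcombination : Prop :=
  (forall i, univ (A i) !=set0) /\
  (forall i, A i = comb_reduct (restriction comb (univ (A i))) i).

End Combination.

Definition p_infty (I : Type) (L : language) (Sig : I -> set L) (U : Type)
    (M : structure (comb_language Sig) U) : set U :=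
  [set x | univ M x /\
           forall i, ~ interp M (inl i : comb_language Sig) [tuple x]].

(* Two structures are elementarily equivalent iff they have the same [Th], so
   the cardinality of this set is the number of pairwise elementarily
   non-equivalent nonempty restrictions of models of [T] to p_infty. *)
Definition e_spectrum (I : Type) (L : language) (Sig : I -> set L)
    (T : set (sentence (comb_language Sig))) :
    set (set (sentence (comb_language Sig))) :=
  [set X | exists (U : Type) (M : structure (comb_language Sig) U),
     [/\ models M T, p_infty M !=set0 & X = Th (restriction M (p_infty M))]].

(* Main.v *)
Require Import Defs.
From mathcomp Require Import all_boot.
From mathcomp Require Import all_classical.

(** Why the theorem holds.  Colour points by subsets of [K]: a point is a triple
of a class (either some [i : nat] or none), a set of colours [S : set K] and a
natural number separating copies.  The structure with universe [P_i] consists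
of the points of class [i], and for each [k : K] it has a unary predicate
holding at the points whose colour set contains [k].  The combination consists
of the points that have a class, so nothing in it realizes [p_infty].

Everything is unary, and a sentence mentions finitely many predicates.  Adding
classless points to the combination does not change its theory: for a finite
set [F] of predicates, a classless point is indistinguishable from a point
with the same colours in a class [i] with [P_i] outside [F], and the copies
provide infinitely many points of each kind.  Hence every counterpart needed
in an Ehrenfeucht-Fraisse game can be found ([monadic_equivalence],
[Th_extended_model]).  For [S : set K], add the classless points of colour set
[S]: these are the realizations of [p_infty], and their theory contains the
sentence that all points have colour [k] exactly when [k] is in [S].  This
yields as many theories as there are subsets of [K] ([limit_theory_inj],
[limit_theory_spectrum]).

Conversely a theory is a set of sentences, so it is enough that there are no
more sentences than elements of [K] ([formula_injection]).  Sentences are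
finite words over [K] and countably many further letters, so this comes down
to injecting the finite sequences over an infinite [K] into [K].  This last
fact, [seq_injection], is proved by Zorn's lemma. *)

Set Implicit Arguments.
Unset Strict Implicit.
Unset Printing Implicit Defensive.

Local Open Scope classical_set_scope.
Local Open Scope card_scope.

(** * Comparing sets by injections *)

Definition partial_bijection (T : Type) (A B : set T) (G : set (T * T)) :
    Prop :=
  (forall p, G p -> A p.1 /\ B p.2) /\
  (forall p q, G p -> G q -> p.1 = q.1 <-> p.2 = q.2).

Lemma partial_bijection_bigcup (T : Type) (A B : set T)
    (F : set (set (T * T))) :
  F `<=` partial_bijection A B -> total_on F subset ->
  partial_bijection A B (\bigcup_(G in F) G).
Proof.
move=> FP Ftot; split=> [p [G FG Gp]|p q [G FG Gp] [H FH Hq]].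
  by have [+ _] := FP _ FG; apply.
have [GH|HG] := Ftot _ _ FG FH.
  by have [_] := FP _ FH; apply => //; exact: GH.
by have [_] := FP _ FG; apply => //; exact: HG.
Qed.

(** A maximal partial bijection between [A] and [B] cannot miss a point on both
sides, since that pair could be added to it. *)
Lemma injective_comparable (T : Type) (A B : set T) :
  (exists2 h : T -> T, set_fun A B h & set_inj A h) \/
  (exists2 h : T -> T, set_fun B A h & set_inj B h).
Proof.
have [G [[GAB Gbij] Gmax]] := Zorn_bigcup (@partial_bijection_bigcup T A B).
have [Afull|/existsNP[a /not_implyP[Aa aG]]] :=
  pselect (forall a, A a -> exists b, G (a, b)).
  left; have /choice[h hG] : forall a, exists b, A a -> G (a, b).
    by move=> a; have [/Afull[b]|] := pselect (A a); [exists b|exists a].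
  exists h => [a Aa|a b /set_mem Aa /set_mem Ab hab].
    by have [] := GAB _ (hG _ Aa).
  exact/(Gbij _ _ (hG _ Aa) (hG _ Ab)).
have [Bfull|/existsNP[b /not_implyP[Bb bG]]] :=
  pselect (forall b, B b -> exists a, G (a, b)).
  right; have /choice[h hG] : forall b, exists a, B b -> G (a, b).
    by move=> b; have [/Bfull[a']|] := pselect (B b); [exists a'|exists b].
  exists h => [x Bx|x y /set_mem Bx /set_mem By hxy].
    by have [] := GAB _ (hG _ Bx).
  exact/(Gbij _ _ (hG _ Bx) (hG _ By)).
exfalso; apply: (Gmax (G `|` [set (a, b)])).
  split=> [|sub]; last by apply: aG; exists b; apply: sub; right.
  by move=> p Gp; left.
split=> [p [/GAB//|->//]|p q [Gp|->] [Gq|->] //=].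
- exact: Gbij.
- by split=> e; exfalso; [apply: aG; exists p.2|apply: bG; exists p.1];
    rewrite -e -surjective_pairing.
- by split=> e; exfalso; [apply: aG; exists q.2|apply: bG; exists q.1];
    rewrite e -surjective_pairing.
Qed.

Lemma injective_card_le (T U : Type) (A : set T) (f : T -> U) :
  injective f -> A #<= [set: U].
Proof.
move=> finj; have fA : {in A &, injective f} by move=> x y _ _ /finj.
have := inj_card_eq fA; rewrite card_eq_le => /andP[_ le].
exact: card_le_trans le (card_leT _).
Qed.

(** * Finite sequences over an infinite type *)

Definition over (T : Type) (A : set T) (s : seq T) : bool :=
  all (fun x => x \in A) s.

Lemma overS (T : Type) (A B : set T) s : A `<=` B -> over A s -> over B s.
Proof.
by move=> AB; apply: sub_all => x /set_mem Ax; apply/mem_set/AB.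
Qed.

(** Rewrites a sequence over [A] and a second set as a sequence over [A] alone:
each entry becomes a block of two letters, the first of which ([a] or [b])
tells whether the entry was in [A] or had to be moved there by [k].  The
leading [a] keeps the code of the empty sequence nonempty, because the
codings considered below may be undefined at the empty sequence. *)
Definition pair_code (T : Type) (A : set T) (k : T -> T) (a b : T)
    (s : seq T) : seq T :=
  a :: flatten [seq if x \in A then [:: a; x] else [:: b; k x] | x <- s].

Lemma pair_code_over (T : Type) (A B : set T) k (a b : T) s :
  A a -> A b -> set_fun B A k -> over (A `|` B) s ->
  over A (pair_code A k a b s).
Proof.
move=> /mem_set Aa /mem_set Ab kBA /=; rewrite Aa /=.
elim: s => //= x s IH /andP[/set_mem ABx /IH os].
case: ifPn => [Ax|/negP nAx] /=; first by rewrite Aa Ax.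
rewrite Ab os andbT; apply/mem_set/kBA.
by case: ABx => // /mem_set.
Qed.

Lemma pair_code_inj (T : Type) (A B : set T) k (a b : T) s t :
  a <> b -> set_inj B k -> over (A `|` B) s -> over (A `|` B) t ->
  pair_code A k a b s = pair_code A k a b t -> s = t.
Proof.
move=> ab kinj + + []; elim: s t => [|x s IH] [|y t] //=.
- by case: ifP.
- by case: ifP.
have inB z : z \in A `|` B -> z \notin A -> z \in B.
  by move=> /set_mem[/mem_set->//|Bz _]; exact/mem_set.
move=> /andP[/inB xB os] /andP[/inB yB ot].
case: ifPn => [_|/xB xB']; case: ifPn => [_|/yB yB'] [] //.
- by move=> -> /IH->.
- by move=> /esym.
- by move=> /kinj -> // /IH ->.
Qed.

(** Zorn's lemma is applied to graphs of injections of the nonempty sequences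
over a set into that set.  The set is read off from the graph, as the letters
of the coded sequences of length one, so that such injections are ordered by
plain inclusion of graphs. *)
Definition alphabet (T : Type) (G : set (seq T * T)) : set T :=
  [set x | exists y, G ([:: x], y)].

(** The empty sequence is left out so that the empty graph qualifies, being the
union of the empty chain.  A sequence may have several codes: single-valuedness
can be restored by choice, while only injectivity matters. *)
Definition list_coding (T : Type) (G : set (seq T * T)) : Prop :=
  [/\ forall s x, G (s, x) -> over (alphabet G) s /\ alphabet G x,
      forall s, s <> [::] -> over (alphabet G) s -> exists x, G (s, x)
    & forall s t x, G (s, x) -> G (t, x) -> s = t].

Lemma alphabetS (T : Type) (G H : set (seq T * T)) :
  G `<=` H -> alphabet G `<=` alphabet H.
Proof. by move=> GH x [y Gxy]; exists y; exact: GH. Qed.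

Lemma list_coding_bigcup (T : Type) (F : set (set (seq T * T))) :
  F `<=` @list_coding T -> total_on F subset ->
  list_coding (\bigcup_(G in F) G).
Proof.
move=> FP Ftot; split.
- move=> s x [G FG Gsx]; have [/(_ _ _ Gsx)[os ox] _ _] := FP _ FG.
  have sub : alphabet G `<=` alphabet (\bigcup_(G in F) G).
    by apply: alphabetS => p Gp; exists G.
  by split; [exact: overS os|exact: sub].
- move=> s s0 os.
  suff [G FG oG] : exists2 G, F G & over (alphabet G) s.
    by have [_ /(_ _ s0 oG)[x Gx] _] := FP _ FG; exists x, G.
  (* the finitely many letters of [s] all appear in one member of the chain *)
  elim: s s0 os => // x [|y s] IH _ /= /andP[/set_mem[z [G FG Gxz]]].
    by move=> _; exists G => //; rewrite mem_set//; exists z.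
  move=> /IH[//|H FH oH].
  have xG : alphabet G x by exists z.
  have [GH|HG] := Ftot _ _ FG FH.
    by exists H => //; apply/andP; split=> //; exact/mem_set/(alphabetS GH).
  exists G => //; apply/andP; split; first exact/mem_set.
  exact: overS (alphabetS HG) oH.
- move=> s t x [G FG Gs] [H FH Ht]; have [GH|HG] := Ftot _ _ FG FH.
    by have [_ _] := FP _ FH; apply; [exact: GH Gs|].
  by have [_ _] := FP _ FG; apply; [exact: Gs|exact: HG].
Qed.

(** A countably infinite set carries a coding; it shows that a maximal coding
does not have an empty alphabet. *)
Lemma list_coding_countable (T : Type) (g : nat -> T) :
  injective g -> list_coding [set p | exists2 s : seq nat,
    s <> [::] & p = (map g s, g (pickle s))].
Proof.
move=> ginj; set G := [set p | _].
have alphE : alphabet G = range g.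
  apply/seteqP; split=> [x [y [[|n []] // _ [-> _]]]|_ [n _ <-]].
    by exists n.
  by exists (g (pickle [:: n])), [:: n].
split.
- move=> _ _ [s _ [-> ->]]; rewrite alphE; split; last by exists (pickle s).
  by rewrite /over all_map; apply/allP => n _ /=; exact/mem_set.
- move=> s s0; rewrite alphE => os.
  have [n sE] : exists n, s = map g n.
    elim: s os {s0} => [|x s IH] /=; first by exists [::].
    by move=> /andP[/set_mem[n _ <-] /IH[m ->]]; exists (n :: m).
  exists (g (pickle n)), n; last by rewrite sE.
  by move=> n0; rewrite sE n0 in s0.
- move=> s t _ [m _ [-> ->]] [n _ [-> /ginj mn]].
  by rewrite (pcan_inj pickleK mn).
Qed.

(** The step that contradicts maximality: if the alphabet [A] has a disjoint
copy [B], the coding extends to sequences over their union.  A sequence that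
is not entirely over [A] is first rewritten over [A], then coded there, and
the code is moved to [B], where it cannot meet the earlier codes. *)
Lemma list_coding_double (T : Type) (G : set (seq T * T)) (a b : T)
    (h : T -> T) :
  list_coding G -> alphabet G a -> alphabet G b -> a <> b ->
  set_fun (alphabet G) (~` alphabet G) h -> set_inj (alphabet G) h ->
  exists2 H, G `<` H & list_coding H.
Proof.
move=> [Gfield Gtot Ginj]; set A := alphabet G => Aa Ab ab hfun hinj.
pose B := h @` A.
have /choice[k kh] : forall y, exists x, B y -> A x /\ h x = y.
  move=> y; have [[x Ax <-]|nBy] := pselect (B y); first by exists x.
  by exists y.
have kfun : set_fun B A k by move=> y /kh[].
have kinj : set_inj B k.
  by move=> x y /set_mem/kh[_ {2}<-] /set_mem/kh[_ {2}<-] ->.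
pose code := pair_code A k a b.
have /choice[f fG] : forall s, exists x, s <> [::] -> over A s -> G (s, x).
  move=> s; have [[s0 os]|nos] := pselect (s <> [::] /\ over A s).
    by have [x Gx] := Gtot _ s0 os; exists x.
  by exists a => s0 os; case: nos.
have fcode s : over (A `|` B) s -> G (code s, f (code s)).
  by move=> os; apply: fG => //; exact: pair_code_over os.
pose N := [set p : seq T * T |
  [/\ p.1 <> [::], over (A `|` B) p.1, ~ over A p.1 & p.2 = h (f (code p.1))]].
have Af s : over (A `|` B) s -> A (f (code s)) by move=> /fcode/Gfield[].
have alphE : alphabet (G `|` N) = A `|` B.
  apply/seteqP; split=> x.
    case=> y [Gxy|[_ /= + _ _]]; first by left; exists y.
    by rewrite andbT => /set_mem.
  have [Ax _|nAx [//|Bx]] := pselect (A x).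
    by have [y Gy] := Ax; exists y; left.
  exists (h (f (code [:: x]))); right; split=> //=.
    by rewrite mem_set//; right.
  by rewrite andbT => /set_mem.
exists (G `|` N).
  split=> [p|sub]; first by left.
  have hA := hfun _ Aa; apply: (hA); exists (h (f (code [:: h a]))).
  apply: sub; right; split=> //=.
    by rewrite mem_set//; right; exists a.
  by rewrite andbT => /set_mem.
split; rewrite ?alphE.
- move=> s x [/Gfield[os Ax]|[/= _ os _ ->]].
    by split; [apply: overS os => z; left|left].
  by split=> //; right; exists (f (code s)) => //; exact: Af.
- move=> s s0 os; have [oA|noA] := pselect (over A s).
    by have [x Gx] := Gtot _ s0 oA; exists x; left.
  by exists (h (f (code s))); right.
- have disj s t x : G (s, x) -> ~ N (t, x).
    move=> /Gfield[_ Ax] [/= _ ot _ xE].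
    by apply: (hfun _ (Af _ ot)); rewrite -xE.
  move=> s t x [Gs|Ns] [Gt|Nt]; first exact: Ginj Gs Gt.
  + by case: (disj _ _ _ Gs Nt).
  + by case: (disj _ _ _ Gt Ns).
  case: Ns Nt => /= _ os _ -> [_ /= ot _ /hinj].
  rewrite !mem_set; try exact: Af.
  move=> /(_ isT isT) e; apply: (@pair_code_inj _ A B k a b) => //.
  by apply: Ginj (fcode _ os) _; rewrite e; exact: fcode.
Qed.

Lemma infinite_nat_inj (T : Type) : infinite_set [set: T] ->
  exists g : nat -> T, injective g.
Proof.
move=> /infiniteP/card_leP[g].
exists (fun n => sval (g (exist _ n (mem_set I)))) => m n /val_inj.
by move=> /(@inj _ _ _ g) e; have [] := e (mem_setT _) (mem_setT _).
Qed.

(** A maximal coding has an alphabet [A] too large for the complement of [A] to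
contain a copy of it, by [list_coding_double].  So the complement injects into
[A], and all sequences can be rewritten over [A] and coded there. *)
Lemma seq_injection (T : Type) : infinite_set [set: T] ->
  exists f : seq T -> T, injective f.
Proof.
move=> /infinite_nat_inj[g ginj].
have [G [Gcod Gmax]] := Zorn_bigcup (@list_coding_bigcup T).
have [Gfield Gtot Ginj] := Gcod.
have [a Aa] : exists a, alphabet G a.
  apply: contrapT => /forallNP nA.
  have G0 : G = set0.
    apply/seteqP; split=> // -[s x] Gsx; have [_ Ax] := Gfield _ _ Gsx.
    exact: nA Ax.
  apply: Gmax (list_coding_countable ginj); rewrite G0; split=> // sub.
  by apply: (sub ([:: g 0], g (pickle [:: 0]))); exists [:: 0].
(* codes of sequences of different lengths give two distinct letters *)
have [c Gc] : exists c, G ([:: a], c) by apply: Gtot => //=; rewrite mem_set.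
have [d Gd] : exists d, G ([:: a; a], d).
  by apply: Gtot => //=; rewrite !mem_set.
have cd : c <> d by move=> cd; rewrite cd in Gc; have := Ginj _ _ _ Gc Gd.
have [_ Ac] := Gfield _ _ Gc; have [_ Ad] := Gfield _ _ Gd.
have [[h hfun hinj]|[k kfun kinj]] :=
  injective_comparable (alphabet G) (~` alphabet G).
  have [H GH Hcod] := list_coding_double Gcod Ac Ad cd hfun hinj.
  by case: (Gmax H).
pose code := pair_code (alphabet G) k c d.
have all_over s : over (alphabet G `|` ~` alphabet G) s.
  by rewrite setUv; elim: s => //= x s ->; rewrite in_setT.
have /choice[f fG] : forall s, exists x, G (code s, x).
  by move=> s; apply: Gtot => //; exact: pair_code_over (all_over s).
exists f => s t e; apply: (pair_code_inj cd kinj (all_over s) (all_over t)).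
by apply: Ginj (fG s) _; rewrite e; exact: fG.
Qed.

Lemma nat_sum_injection (T : Type) : infinite_set [set: T] ->
  exists f : nat + T -> T, injective f.
Proof.
move=> Tinf; have [g ginj] := infinite_nat_inj Tinf.
have [f finj] := seq_injection Tinf.
exists (fun c => match c with inl n => f [:: g n] | inr x => f [:: x; x] end).
by case=> [m|x] [n|y] /finj // [] => [/ginj|] ->.
Qed.

(** * Counting formulas *)

Fixpoint formula_tree (L : language) (n : nat) (phi : formula L n) :
    GenTree.tree L :=
  match phi with
  | FBot _ => GenTree.Node 0 [::]
  | FEq _ x y => GenTree.Node 1 [:: GenTree.Node x [::]; GenTree.Node y [::]]
  | FRel _ s x =>
      GenTree.Node 2
        (GenTree.Leaf s :: [seq GenTree.Node (nat_of_ord i) [::] | i <- x])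
  | FImp _ f g => GenTree.Node 3 [:: formula_tree f; formula_tree g]
  | FAll _ f => GenTree.Node 4 [:: formula_tree f]
  end.

Definition tree_variable (L : language) (n : nat) (t : GenTree.tree L) :
    option 'I_n :=
  if t is GenTree.Node k _ then insub k else None.

(** A left inverse of [formula_tree], so that injectivity follows without
inverting equalities in the dependent type of formulas.  The number of free
variables, which the tree does not record, is an argument. *)
Fixpoint tree_formula (L : language) (t : GenTree.tree L) :
    forall n, option (formula L n) :=
  match t with
  | GenTree.Node 0 [::] => fun n => Some (FBot L n)
  | GenTree.Node 1 [:: t; u] => fun n =>
      if (tree_variable n t, tree_variable n u) is (Some x, Some y)
      then Some (FEq L x y) else None
  | GenTree.Node 2 (GenTree.Leaf s :: ts) => fun n =>
      omap (FRel s) (insub (pmap (@tree_variable L n) ts))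
  | GenTree.Node 3 [:: t; u] => fun n =>
      if (tree_formula t n, tree_formula u n) is (Some f, Some g)
      then Some (FImp f g) else None
  | GenTree.Node 4 [:: t] => fun n =>
      omap (@FAll L n) (tree_formula t n.+1)
  | _ => fun n => None
  end.

Lemma formula_treeK (L : language) (n : nat) (phi : formula L n) :
  tree_formula (formula_tree phi) n = Some phi.
Proof.
elim: phi => //= {}n.
- by move=> x y; rewrite !valK.
- move=> s x; suff -> : pmap (@tree_variable L n)
      [seq GenTree.Node (nat_of_ord i) [::] | i <- x] = x by rewrite valK.
  by elim: (tval x) => //= i r ->; rewrite valK.
- by move=> f -> g ->.
- by move=> f ->.
Qed.

Lemma formula_injection (L : language) (K : Type) (n : nat) (c : L -> K) :
  infinite_set [set: K] -> injective c ->
  exists f : formula L n -> K, injective f.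
Proof.
move=> Kinf cinj; have [f finj] := seq_injection Kinf.
have [g ginj] := nat_sum_injection Kinf.
pose h (x : nat + L) :=
  g (match x with inl m => inl m | inr s => inr (c s) end).
have hinj : injective h by case=> [m|s] [k|t] /ginj // [] => [|/cinj] ->.
exists (fun phi => f (map h (GenTree.encode (formula_tree phi)))).
move=> phi psi /finj/(inj_map hinj)/(pcan_inj (GenTree.codeK L)) e.
by apply: Some_inj; rewrite -!formula_treeK e.
Qed.

(** * Elementary equivalence in unary languages *)

Fixpoint symbols (L : language) (n : nat) (phi : formula L n) : set L :=
  match phi with
  | FBot _ | FEq _ _ _ => set0
  | FRel _ s _ => [set s]
  | FImp _ f g => symbols f `|` symbols g
  | FAll _ f => symbols f
  end.

Lemma finite_symbols (L : language) (n : nat) (phi : formula L n) :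
  finite_set (symbols phi).
Proof. by elim: phi => //= *; rewrite finite_setU. Qed.

Definition monadic (L : language) : Prop := forall s : L, arity s = 1.

(** The arity of a symbol of a monadic language is only provably equal to one,
so the unary predicate is evaluated at a constant tuple instead of casting. *)
Definition holds (L : language) (U : Type) (M : structure L U) (s : L) (x : U) :
    Prop :=
  interp M s (nseq_tuple (arity s) x).

Definition alike (L : language) (U V : Type) (M : structure L U)
    (N : structure L V) (F : set L) (x : U) (y : V) : Prop :=
  [/\ univ M x, univ N y & forall s, F s -> holds M s x <-> holds N s y].

Definition matching (L : language) (U V : Type) (M : structure L U)
    (N : structure L V) (F : set L) (n : nat) (e : n.-tuple U)
    (e' : n.-tuple V) : Prop :=
  (forall i, alike M N F (tnth e i) (tnth e' i)) /\
  (forall i j, tnth e i = tnth e j <-> tnth e' i = tnth e' j).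

(** The finite set [E] to be avoided makes the realizations in [N] of each type
over finitely many symbols infinite in number. *)
Definition duplicates_types (L : language) (U V : Type) (M : structure L U)
    (N : structure L V) : Prop :=
  forall (F : set L) (E : set V) x, finite_set F -> finite_set E -> univ M x ->
  exists2 y, alike M N F x y & ~ E y.

Lemma matching_sym (L : language) (U V : Type) (M : structure L U)
    (N : structure L V) F n (e : n.-tuple U) (e' : n.-tuple V) :
  matching M N F e e' -> matching N M F e' e.
Proof.
move=> [al eq]; split=> [i|i j]; last by split=> /eq.
by have [Mi Ni ss] := al i; split=> // s /ss[? ?]; split.
Qed.

(** The forth step of the game.  A point that occurs in the tuple is answered by
the matching entry, any other by a fresh point of the same type. *)
Lemma matching_extend (L : language) (U V : Type) (M : structure L U)
    (N : structure L V) F n (e : n.-tuple U) (e' : n.-tuple V) x :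
  finite_set F -> duplicates_types M N -> matching M N F e e' -> univ M x ->
  exists2 y, univ N y & matching M N F (cons_tuple x e) (cons_tuple y e').
Proof.
move=> Ffin dup [al eq] Mx.
suff [y al_y eq_y] : exists2 y, alike M N F x y &
    forall i, x = tnth e i <-> y = tnth e' i.
  exists y; first by case: al_y.
  split=> [i|i j].
    by case: (unliftP ord0 i) => [k|] ->; rewrite ?tnthS ?tnth0.
  case: (unliftP ord0 i) => [k|] ->; case: (unliftP ord0 j) => [l|] ->;
    rewrite ?tnthS ?tnth0 //.
  by split=> /esym/eq_y/esym.
have [[i <-]|new] := pselect (exists i, tnth e i = x).
  by exists (tnth e' i).
have [|y al_y y_new] := dup F (range (tnth e')) x Ffin _ Mx.
  exact/finite_image/finite_finset.
exists y => // i; split=> [e_i|e_i]; exfalso; first by apply: new; exists i.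
by apply: y_new; exists i.
Qed.

Lemma sat_matching (L : language) (U V : Type) (M : structure L U)
    (N : structure L V) F n (phi : formula L n) (e : n.-tuple U)
    (e' : n.-tuple V) :
  monadic L -> finite_set F -> duplicates_types M N -> duplicates_types N M ->
  symbols phi `<=` F -> matching M N F e e' -> sat M phi e <-> sat N phi e'.
Proof.
move=> mon Ffin MN NM; elim: phi e e' => {n} /=.
- by [].
- by move=> n x y e e' _ [_]; apply.
- move=> n s x e e' sF [al _].
  (* an atom of a monadic language is about a single variable *)
  have constE W (d : n.-tuple W) : map_tuple (tnth d) x =
      nseq_tuple (arity s) (tnth d (tnth x (Ordinal (arity_gt0 s)))).
    apply: eq_from_tnth => i; rewrite tnth_map tnth_nseq.
    congr (tnth d (tnth x _)); apply: val_inj => /=.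
    by have := ltn_ord i; rewrite [X in _ < X]mon; case: val.
  rewrite !constE; have [_ _] := al (tnth x (Ordinal (arity_gt0 s))).
  by apply; exact: sF.
- move=> n f IHf g IHg e e'; rewrite subUset => -[fF gF] ee'.
  have [f1 f2] := IHf _ _ fF ee'; have [g1 g2] := IHg _ _ gF ee'.
  by split=> fg /[dup]; auto.
- move=> n f IH e e' fF ee'; split=> sf y My.
    have [x Mx xy] := matching_extend Ffin NM (matching_sym ee') My.
    by apply/(IH _ _ fF (matching_sym xy))/sf.
  have [x Mx xy] := matching_extend Ffin MN ee' My.
  by apply/(IH _ _ fF xy)/sf.
Qed.

Lemma monadic_equivalence (L : language) (U V : Type) (M : structure L U)
    (N : structure L V) :
  monadic L -> duplicates_types M N -> duplicates_types N M -> Th M = Th N.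
Proof.
move=> mon MN NM; apply/seteqP.
have eqv phi : sat M phi (nil_tuple U) <-> sat N phi (nil_tuple V).
  apply: (sat_matching (F := symbols phi)) => //; first exact: finite_symbols.
  by split=> -[].
by split=> phi /eqv.
Qed.

(** * The combination and its extensions *)

Lemma structure_ext (L : language) (U : Type) (M N : structure L U) :
  univ M = univ N -> interp M = interp N -> M = N.
Proof.
case: M N => [A f fA] [B g gB] /= AB fg; case: B / AB gB => gB.
by case: g / fg gB => gB; congr Structure; exact: Prop_irrelevance.
Qed.

Section Construction.
Variable K : Type.

Definition colour_language : language :=
  @Language K (fun=> 1) (fun=> erefl).

Definition all_colours (i : nat) : set colour_language := setT.

(** The class of the point, if it has one; its colours; the copy number. *)
Definition point : Type := (option nat * set K * nat)%type.

Definition class_structure_interp (i : nat)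
    (s : sublanguage (all_colours i)) : set ((arity s).-tuple point) :=
  [set a | forall k, (tnth a k).1.1 = Some i /\ (tnth a k).1.2 (sval s)].

Definition class_structure (i : nat) :
    structure (sublanguage (all_colours i)) point :=
  @Structure (sublanguage (all_colours i)) point [set x | x.1.1 = Some i]
    (@class_structure_interp i) (fun s a h k => proj1 (h k)).

Definition labelled (t : comb_language all_colours) (x : point) : Prop :=
  match t with inl i => x.1.1 = Some i | inr s => x.1.2 (sval s) end.

(** [W] restricts the colour sets of the classless points; for empty [W] there
are none, and [extended_model W] is the combination. *)
Definition points_over (W : set (set K)) : set point :=
  [set x | x.1.1 = None -> W x.1.2].

Definition extended_model (W : set (set K)) :
    structure (comb_language all_colours) point :=
  @Structure (comb_language all_colours) point (points_over W)
    (fun t => [set a | forall k,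
       points_over W (tnth a k) /\ labelled t (tnth a k)])
    (fun t a h k => proj1 (h k)).

Lemma class_structure_Pcombination : is_Pcombination class_structure.
Proof.
split=> [i|i]; first by exists (Some i, set0, 0).
apply: structure_ext => /=.
  apply/seteqP; split=> [x xi|x []//].
  by split=> //; exists i.
apply: functional_extensionality_dep => s; apply/seteqP; split=> a /=.
  by move=> ai; split=> [|k]; [exists i, (svalP s) => k|]; case: (ai k).
by move=> [[j [h aj]] ai] k; split=> //; case: (aj k).
Qed.

Lemma comb_class_structure : comb class_structure = extended_model set0.
Proof.
apply: structure_ext => /=.
  apply/seteqP; split=> [x [i _ xi]|[[[i|] S] m] //= h].
  - by rewrite /points_over /= xi.
  - by exists i.
  - by case: h.
apply: functional_extensionality_dep => -[i|s]; apply/seteqP; split=> a /=.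
- move=> ai k; rewrite (ord1 k); split=> //.
  by rewrite /points_over /= [X in X = _]ai.
- by move=> /(_ ord0)[].
- by move=> [j [h aj]] k; have [e ?] := aj k; split=> //;
    rewrite /points_over /= e.
(* the class of the first entry, which exists, is the class of the tuple *)
move=> h; have [ne _] := h ord0.
case ae : (tnth a ord0).1.1 ne => [j|] ne; last by case: (ne ae).
exists j, I => k; rewrite (ord1 k); split=> //.
by have [] := h ord0.
Qed.

Lemma comb_colour_monadic : monadic (comb_language all_colours).
Proof. by case. Qed.

Lemma extended_model_holds W t x : points_over W x ->
  holds (extended_model W) t x <-> labelled t x.
Proof.
move=> Wx; split=> [h|lx k]; last by rewrite tnth_nseq.
by have [] := h (Ordinal (arity_gt0 t)); rewrite tnth_nseq.
Qed.

(** A number [m] occurring neither in [E] nor in [F] serves twice: as a copy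
number, it makes the new point avoid [E]; as a class, it replaces a missing one
without [F] noticing, since [P_m] is not in [F]. *)
Lemma extended_model_duplicates W W' :
  duplicates_types (extended_model W) (extended_model W').
Proof.
move=> F E x Ffin Efin Wx.
(* [0] is a dummy value at the colour symbols *)
pose class_of (t : comb_language all_colours) := if t is inl i then i else 0.
have usedfin : finite_set (snd @` E `|` class_of @` F).
  by rewrite finite_setU; split; exact: finite_image.
have [m /not_orP[mE mF]] : exists m, ~ (snd @` E `|` class_of @` F) m.
  apply: contrapT => /forallNP all; apply: infinite_nat.
  by apply: sub_finite_set usedfin => m _; apply: contrapT; exact: all.
pose y : point := (Some (odflt m x.1.1), x.1.2, m).
exists y; last by move=> Ey; apply: mE; exists y.
split=> // t Ft; rewrite !extended_model_holds//.
case: t Ft => [i|s] //= Fi; case: x.1.1 => [//|] /=; split=> // -[mi].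
by case: mF; exists (inl i).
Qed.

Lemma Th_extended_model W : Th (extended_model W) = Th (comb class_structure).
Proof.
rewrite comb_class_structure.
by apply: monadic_equivalence; [exact: comb_colour_monadic|
  exact: extended_model_duplicates|exact: extended_model_duplicates].
Qed.

Lemma p_infty_extended_model W :
  p_infty (extended_model W) = [set x | x.1.1 = None /\ W x.1.2].
Proof.
apply/seteqP; split=> x /=.
  move=> [Wx]; rewrite /points_over /= in Wx.
  case xe : x.1.1 Wx => [i|] Wx H; last by split=> //; exact: Wx.
  by case: (H i) => k; rewrite (ord1 k).
by move=> [x0 Wx]; split=> // i /(_ ord0)[_ /=]; rewrite x0.
Qed.

Definition limit_theory (S : set K) :
    set (sentence (comb_language all_colours)) :=
  Th (restriction (extended_model [set S]) (p_infty (extended_model [set S]))).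

Lemma limit_theory_spectrum S :
  e_spectrum (Th (comb class_structure)) (limit_theory S).
Proof.
exists point, (extended_model [set S]); split=> //.
  by rewrite -(Th_extended_model [set S]).
by exists (None, S, 0); rewrite p_infty_extended_model.
Qed.

Definition colour_symbol (k : K) : comb_language all_colours :=
  inr (exist _ (k : colour_language) (ex_intro _ 0 I)).

(** [S] is recovered as the set of colours common to all points. *)
Lemma limit_theory_inj : injective limit_theory.
Proof.
pose every (k : K) : sentence (comb_language all_colours) :=
  FAll (@FRel _ 1 (colour_symbol k) [tuple ord0]).
have everyE S k : limit_theory S (every k) <-> S k.
  rewrite /limit_theory p_infty_extended_model.
  split=> /= [h|Sk x [Wx [x0 xS]]].
    have [] := h (None, S, 0); first by [].
    by move=> /(_ ord0)[].
  by split=> j; rewrite (ord1 j)/=; [split; [|rewrite /= xS]|].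
move=> S S' e; apply/seteqP; split=> k /everyE.
  by rewrite e => /everyE.
by rewrite -e => /everyE.
Qed.

End Construction.

Theorem proposition4p13 (K : Type) (K_infinite : infinite_set [set: K]) :
  exists (I : Type) (L : language) (Sig : I -> set L) (U : Type)
    (A : forall i, structure (sublanguage (Sig i)) U),
    [/\ is_Pcombination A,
        [set: comb_language Sig] #= [set: K]
      & e_spectrum (Th (comb A)) #= [set: set K]].
Proof.
exists nat, (colour_language K), (@all_colours K), (point K).
exists (@class_structure K).
have [g ginj] := nat_sum_injection K_infinite.
pose c (t : comb_language (@all_colours K)) : K :=
  g (match t with inl i => inl i | inr s => inr (sval s) end).
have cinj : injective c.
  case=> [i|[s hs]] [j|[t ht]] /ginj // [] => [->//|/= st].
  by congr inr; exact: eq_exist.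
split; first exact: class_structure_Pcombination.
  rewrite card_eq_le; apply/andP; split; first exact: injective_card_le cinj.
  by apply: (@injective_card_le _ _ _ (@colour_symbol K)) => k l [].
rewrite card_eq_le; apply/andP; split.
  have [f finj] := formula_injection 0 K_infinite cinj.
  apply: (@injective_card_le _ _ _ (fun X => f @` X)) => X Y /seteqP[XY YX].
  apply/seteqP; split=> phi Xphi.
    by have [psi Ypsi /finj<-] : (f @` Y) (f phi) by apply: XY; exists phi.
  by have [psi Xpsi /finj<-] : (f @` X) (f phi) by apply: YX; exists phi.
have fA : {in [set: set K] &, injective (@limit_theory K)}.
  by move=> S S' _ _ /limit_theory_inj.
have := inj_card_eq fA; rewrite card_eq_le => /andP[_ le].
apply: card_le_trans le (subset_card_le _) => _ [S _ <-].
exact: limit_theory_spectrum.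
Qed.
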